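(* Let $\mathcal U$ be any free ultrafilter on $\mathbb N$ and let $(\theta_k)_{k\ge1}\subset(0,1)$ satisfy $\theta_k\to0$. For $\alpha\in(0,1)$ let $P_\alpha^\theta=\alpha u+(1-\alpha)R_0^\theta$, where $u$ and $R_0^\theta$ are as defined in the context. Then for every $\alpha\in(0,1)$, $P_\alpha^\theta$ is a merely finitely additive probability function on $\mathcal B$, satisfies $P_\alpha^\theta([\omega\upharpoonright n])>0$ for all $\omega\in\Omega$, $n\in\mathbb N$, and converges to the truth almost uniformly. Distinct values of $\alpha$ give distinct probability functions. Consequently there are uncountably many merely finitely additive probability functions on $\mathcal B$ that give every $[\omega\upharpoonright n]$ positive probability and converge to the truth almost uniformly.
   Context: $\mathbb N=\{1,2,3,\dots\}$; $\Omega=\{0,1\}^{\mathbb N}$ carries the product topology, and $\mathcal B$ is its Borel $\sigma$-algebra. For $\omega\in\Omega$, $n\in\mathbb N$, $[\omega\upharpoonright n]=\{\omega':\omega'_i=\omega_i,\ 1\le i\le n\}$. A probability function on $\mathcal B$ is a finitely additive map $P:\mathcal B\to[0,1]$ with $P(\Omega)=1$; it is merely finitely additive if it is not countably additive. If every $[\omega\upharpoonright n]$ has positive probability, $P_n(A)(\omega)=P(A\cap[\omega\upharpoonright n])/P([\omega\upharpoonright n])$. $P$ converges to the truth almost uniformly if for every $A\in\mathcal B$ and $\varepsilon>0$ there is $E\in\mathcal B$ with $P(E)<\varepsilon$ such that for every $r>0$ there is $N$ with $|P_n(A)(\omega)-\mathbf 1_A(\omega)|<r$ for all $n\ge N$,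 $\omega\notin E$. Construction. For $k\ge1$ let $d_k\in\Omega$ be the path with a $1$ in coordinate $k$ and $0$ in every other coordinate. Let $Q$ be the fair-coin measure (the product of uniform probabilities on $\{0,1\}$). Let $T_k:\Omega\to\Omega$, $T_k(x)=0^{k-1}1x$ ($k-1$ zeros, then a $1$, then $x$), and $\nu_k=Q\circ T_k^{-1}$. Let $\delta_x$ be the point mass at $x$ and $t_k=2^{-k}$. Put $$R_0^\theta=\sum_{k=1}^\infty t_k\big((1-\theta_k)\delta_{d_k}+\theta_k\nu_k\big),$$ a countably additive Borel probability. Define $u(A)=1$ if $\{k:d_k\in A\}\in\mathcal U$ and $u(A)=0$ otherwise, for $A\in\mathcal B$. A free ultrafilter on $\mathbb N$ is an ultrafilter containing no finite set. *)

(* Defs.v *)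
From HB Require Import structures.
From mathcomp Require Import all_boot all_order all_algebra.
From mathcomp Require Import all_classical all_reals all_analysis.

Set Implicit Arguments.
Unset Strict Implicit.
Unset Printing Implicit Defensive.

Import Order.TTheory GRing.Theory Num.Theory.
Import numFieldNormedType.Exports.

Local Open Scope classical_set_scope.
Local Open Scope ring_scope.

(* Sequences are indexed from 0: the index k : nat stands for the positive
   integer k + 1, both for coordinates of points of Omega and for the families
   d_k, T_k, t_k, theta_k.  Only the length n of a prefix is not shifted. *)

Notation Omega := (g_sigma_algebraType (@open cantor_space)).

Definition cyl (w : Omega) (n : nat) : set Omega :=
  [set w' | forall i, (i < n)%N -> w' i = w i].

Lemma measurable_coord (i : nat) (B : set bool) :
  measurable ([set w | B (w i)] : set Omega).
Proof.
apply: sub_sigma_algebra.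
have /continuousP c : continuous (proj i : prod_topology (fun=> bool) -> bool).
  exact: (@proj_continuous nat (fun=> bool) i).
exact: (c B (discrete_open _)).
Qed.

Lemma measurable_rect (P : set nat) (A : nat -> set bool) :
  measurable ([set w | forall i, P i -> A i (w i)] : set Omega).
Proof.
rewrite (_ : [set w | _] =
    \bigcap_(i in P) ([set w | A i (w i)] : set Omega)) //.
by apply: bigcap_measurableType => i _; exact: measurable_coord.
Qed.

Lemma measurable_cyl (w : Omega) (n : nat) : measurable (cyl w n).
Proof. exact: (measurable_rect [set i | (i < n)%N] (fun i => [set w i])). Qed.

Lemma open_cyl (U : set cantor_space) (w : cantor_space) :
  open U -> U w -> exists n, cyl w n `<=` U.
Proof.
move=> oU Uw; apply: contrapT => /forallNP h.
have {}h n : exists x : cantor_space, cyl w n x /\ ~ U x.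
  by have /existsNP[x /not_implyP[]] := h n; exists x.
have [f fP] := choice h.
suff : f @ \oo --> w.
  have nU : nbhs w U by apply: open_nbhs_nbhs.
  by move=> /(_ U nU)[N _ /(_ N (leqnn N))]; exact: (fP N).2.
apply/cvg_sup => i A /=.
rewrite (@nbhsE (initial_topology (@proj nat (fun=> bool) i))) => -[B [[C _ CB] Bw] BA].
exists i.+1 => // n /= lin; apply: BA; rewrite -CB /=.
move: Bw; rewrite -CB /= /proj; have [/(_ i lin) -> _] := fP n; exact.
Qed.

(* Product of the uniform probabilities on bool: finite-dimensional
   measurable rectangles have product measure. *)
Definition is_fair_coin (R : realType) (Q : probability Omega R) : Prop :=
  forall (n : nat) (A : nat -> set bool),
    Q [set w | forall i, (i < n)%N -> A i (w i)] =
    (\prod_(i < n) bernoulli_prob (2^-1 : R) (A i))%E.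

(* Existence: the image of Lebesgue measure on [0, 1[ under binary digits. *)
Section fair_coin_exists.
Variable R : realType.

Let D : set (measurableTypeR R) := `[0, 1[%classic.

Let mD : measurable D. Proof. exact: measurable_itv. Qed.

Let digits (x : measurableTypeR R) : Omega :=
  fun n => odd (Num.truncn (x * 2 ^+ n.+1)).

Fixpoint prefix_nat (w : nat -> bool) (n : nat) : nat :=
  if n is m.+1 then ((prefix_nat w m).*2 + w m)%N else 0%N.

Let truncn_double (x : R) : 0 <= x ->
  (Num.truncn (x * 2))./2 = Num.truncn x.
Proof.
move=> x0; apply/esym/truncn_def.
have x20 : 0 <= x * 2 by rewrite mulr_ge0.
have /andP[] := truncn_itv x20; set m := Num.truncn _ => m1 m2.
have m3 : (m./2.*2 <= m)%N by rewrite -[leqRHS]odd_double_half leq_addl.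
have m4 : (m.+1 <= m./2.+1.*2)%N.
  by rewrite -{1}[m]odd_double_half doubleS; case: (odd m).
rewrite -(@ler_pM2r _ 2)// -(@ltr_pM2r _ 2 _ x)// -!natrM !muln2.
by rewrite (le_trans _ m1) ?ler_nat//= (lt_le_trans m2)// ler_nat.
Qed.

Let digits_cyl (w : Omega) n (x : R) : 0 <= x < 1 ->
  cyl w n (digits x) <-> Num.truncn (x * 2 ^+ n) = prefix_nat w n.
Proof.
move=> /andP[x0 x1]; elim: n => [|n ih].
  split=> // _ /=; apply: truncn_def; by rewrite expr0 mulr1 x0.
have xn0 : 0 <= x * 2 ^+ n by rewrite mulr_ge0// exprn_ge0.
have E := truncn_double xn0.
rewrite -mulrA -exprSr in E.
have E2 := odd_double_half (Num.truncn (x * 2 ^+ n.+1)).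
rewrite E in E2.
split=> [h|/= h].
  have /ih t : cyl w n (digits x) by move=> i /ltnW; exact: h.
  rewrite -E2 t /=; have := h n (ltnSn n); rewrite /digits => ->.
  by rewrite addnC.
have hodd : odd (Num.truncn (x * 2 ^+ n.+1)) = w n.
  by rewrite h oddD odd_double /=; case: (w n).
have ht : Num.truncn (x * 2 ^+ n) = prefix_nat w n.
  by rewrite -E h halfD odd_double doubleK /=; case: (w n); rewrite /= ?addn0.
move=> i; rewrite ltnS leq_eqVlt => /orP[/eqP->//|].
exact: (proj2 ih ht i).
Qed.

Let digits_preimage (w : Omega) n :
  D `&` digits @^-1` cyl w n =
  `[(prefix_nat w n)%:R / 2 ^+ n, (prefix_nat w n).+1%:R / 2 ^+ n[%classic.
Proof.
have n0 : (0 : R) < 2 ^+ n by rewrite exprn_gt0.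
have lt2 : (prefix_nat w n < 2 ^ n)%N.
  elim: n {n0} => // n ih; rewrite expnS mul2n /=.
  apply: (@leq_trans (prefix_nat w n).+1.*2); last by rewrite leq_double.
  by rewrite doubleS; case: (w n); rewrite ?addn1 ?addn0.
apply/seteqP; split=> x /=; rewrite !in_itv /=.
  rewrite /D /= in_itv /= => -[x01 /(digits_cyl w n x01) <-].
  rewrite ler_pdivrMr// ltr_pdivlMr//; apply: truncn_itv.
  by have /andP[x0 _] := x01; rewrite mulr_ge0// ltW.
rewrite ler_pdivrMr// ltr_pdivlMr// => /andP[h1 h2].
have x01 : 0 <= x < 1.
  rewrite -(@pmulr_lge0 _ (2 ^+ n))// (le_trans _ h1)//=.
  rewrite -(@ltr_pM2r _ (2 ^+ n))// mul1r (lt_le_trans h2)//.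
  by rewrite -natrX ler_nat.
split; first by rewrite /D /= in_itv.
by apply/digits_cyl => //; apply: truncn_def; rewrite h1.
Qed.

Let digits_measurable : measurable_fun D digits.
Proof.
apply: measurability => // _ [U oU <-].
pose F (s : seq bool) : set (measurableTypeR R) :=
  if `[< cyl (nth false s) (size s) `<=` U >]
  then D `&` digits @^-1` cyl (nth false s) (size s) else set0.
rewrite (_ : _ `&` _ = \bigcup_s F s); last first.
  apply/seteqP; split=> [x [Dx /= Ux]|x [s _]]; last first.
    by rewrite /F; case: asboolP => // sU [Dx sx]; split=> //; exact: sU.
  have [n nU] := open_cyl oU Ux.
  pose s := mkseq (digits x) n.
  have sz : size s = n by rewrite size_mkseq.
  have sE : cyl (nth false s) (size s) = cyl (digits x) n.
    by apply/seteqP; split=> y; rewrite /cyl /= sz => h i ni;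
      rewrite h// nth_mkseq.
  by exists s => //; rewrite /F sE; case: asboolP.
apply: countable_bigcupT_measurable => // s.
by rewrite /F; case: ifP => // _; rewrite digits_preimage; exact: measurable_itv.
Qed.

Let coin0 : set Omega -> \bar R :=
  fun A => lebesgue_measure (D `&` digits @^-1` A).

Let coin00 : coin0 set0 = 0%E.
Proof. by rewrite /coin0 preimage_set0 setI0 measure0. Qed.

Let coin0_ge0 A : (0 <= coin0 A)%E. Proof. exact: measure_ge0. Qed.

Let coin0_sigma_additive : semi_sigma_additive coin0.
Proof.
move=> F mF tF mUF; rewrite /coin0 preimage_bigcup setI_bigcupr.
apply: measure_semi_sigma_additive.
- by move=> n; exact: digits_measurable.
- apply/trivIsetP => i j _ _ ij.
  have /trivIsetP/(_ i j Logic.I Logic.I ij) Fij := tF.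
  rewrite -subset0 => x [[_ xi] [_ xj]].
  by have : (F i `&` F j) (digits x) by []; rewrite Fij.
- apply: bigcup_measurable => n _; exact: digits_measurable.
Qed.

#[local] HB.instance Definition _ := isMeasure.Build _ _ _
  coin0 coin00 coin0_ge0 coin0_sigma_additive.

Let coin0T : coin0 setT = 1%E.
Proof.
by rewrite /coin0 preimage_setT setIT lebesgue_measure_itv /= lte_fin ltr01
  sube0.
Qed.

#[local] HB.instance Definition _ := Measure_isProbability.Build _ _ _ coin0 coin0T.

Let coin0_cyl w n : coin0 (cyl w n) = (2^-1 ^+ n)%:E.
Proof.
rewrite /coin0 digits_preimage lebesgue_measure_itv /= lte_fin.
rewrite ltr_pM2r ?invr_gt0 ?exprn_gt0// ltr_nat ltnSn -EFinB -mulrBl.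
by rewrite -natrB// subSnn mul1r exprVn.
Qed.

Let bern2 (B : set bool) : bernoulli_prob (2^-1 : R) B =
  (2^-1 * (true \in B)%:R + 2^-1 * (false \in B)%:R)%:E.
Proof.
have h : 0 <= (2^-1 : R) <= 1 by rewrite invr_ge0 ler0n invf_le1 ?ler1n ?ltr0n.
rewrite bernoulli_probE// !diracE -!EFinM -EFinD; congr (_ + _ * _)%:E.
by rewrite /unstable.onem [X in X - _](splitr 1) mul1r addrK.
Qed.

Let part (A : nat -> set bool) m d (w : Omega) : set Omega :=
  [set w' | forall i, (i < m + d)%N ->
    (if (i < m)%N then [set w i] else A i) (w' i)].

Let upd (w : Omega) (m : nat) (b : bool) : Omega :=
  fun i => if i == m then b else w i.

Let mpart A m d w : measurable (part A m d w).
Proof.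
exact: (measurable_rect [set i | (i < m + d)%N]
  (fun i => if (i < m)%N then [set w i] else A i)).
Qed.

Let partS A m d w b :
  coin0 (part A m d.+1 w `&` [set w' | w' m = b]) =
  ((b \in A m)%:R%:E * coin0 (part A m.+1 d (upd w m b)))%E.
Proof.
have [Ab|Ab] := boolP (b \in A m); last first.
  rewrite mul0e -coin00; congr coin0; rewrite -subset0 => w' [/(_ m) + wb].
  rewrite ltnn addnS ltnS leq_addr => /(_ isT) Am.
  by move: Ab; rewrite notin_setE -wb; apply.
have E i : (i < m.+1)%N = (i == m) || (i < m)%N by rewrite ltnS leq_eqVlt.
rewrite mul1e; congr coin0; apply/seteqP; split=> w'.
  move=> [h wb] i; rewrite addSnnS E /upd => /h.
  by have [->|im] := eqVneq i m; rewrite //= => _; exact: wb.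
move=> h; have wb : w' m = b.
  have := h m; rewrite ltnSn /upd /= eqxx; apply.
  by rewrite addSn ltnS leq_addr.
split=> // i; rewrite -addSnnS => /h; rewrite E /upd.
have [->|im] := eqVneq i m => //= _.
by rewrite ltnn wb; exact: set_mem.
Qed.

Let coin0_part A d : forall m w,
  coin0 (part A m d w) =
  ((2^-1 ^+ m)%:E * \prod_(i < d) bernoulli_prob (2^-1 : R) (A (m + i)%N))%E.
Proof.
elim: d => [|d ih] m w.
  rewrite big_ord0 mule1 -(coin0_cyl w); congr coin0.
  apply/seteqP; split=> x h i; first by have := h i; rewrite addn0 => + im; rewrite im; apply.
  by rewrite addn0 => im; rewrite im; exact: h.
pose S b := part A m d.+1 w `&` [set w' | w' m = b].
have mS b : measurable (S b).
  apply: measurableI; first exact: mpart.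
  exact: (measurable_coord m [set b]).
have -> : coin0 (part A m d.+1 w) = (coin0 (S true) + coin0 (S false))%E.
  rewrite (_ : part A m d.+1 w = S true `|` S false).
    apply: measureU => //; rewrite -subset0 => x [[_ h1] [_ h2]].
    by move: h1 h2 => /= ->.
  rewrite /S -setIUr; apply/esym/setIidl => x _ /=.
  by case: (x m); [left|right].
rewrite !partS !ih big_ord_recl addn0 bern2.
under [in RHS]eq_bigr do rewrite /= /bump /= add1n -addSnnS.
rewrite !muleA -ge0_muleDl; first last.
- by rewrite -EFinM lee_fin mulr_ge0// exprn_ge0// invr_ge0.
- by rewrite -EFinM lee_fin mulr_ge0// exprn_ge0// invr_ge0.
congr (_ * _)%E; rewrite -!EFinM -EFinD exprSr; congr _%:E.
by rewrite mulrDr !(mulrC _%:R) !mulrA.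
Qed.

Lemma fair_coin_exists : exists Q : probability Omega R, is_fair_coin Q.
Proof.
exists coin0 => n A; have := coin0_part A n 0 point.
by rewrite expr0 mul1e.
Qed.

End fair_coin_exists.

Definition fair_coin (R : realType) : probability Omega R :=
  projT1 (cid (fair_coin_exists R)).

Lemma fair_coinP (R : realType) : is_fair_coin (fair_coin R).
Proof. exact: projT2 (cid (fair_coin_exists R)). Qed.

(* The Borel sets, bundled, so that functions on the Borel sigma-algebra have
   no values outside it. *)
Record borel := Borel { bset :> set Omega; borelP : measurable bset }.

Definition borelT : borel := Borel measurableT.
Definition borelI (A B : borel) : borel :=
  Borel (measurableI _ _ (borelP A) (borelP B)).
Definition borelU (A B : borel) : borel :=
  Borel (measurableU _ _ (borelP A) (borelP B)).
Definition borel_bigcup (F : nat -> borel) : borel :=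
  Borel (bigcupT_measurable _ (fun n => borelP (F n))).
Definition borel_cyl (w : Omega) (n : nat) : borel :=
  Borel (measurable_cyl w n).

Section probability_functions.
Variable R : realType.
Implicit Type P : borel -> R.

Definition probability_function P : Prop :=
  [/\ forall A, 0 <= P A <= 1,
      P borelT = 1 &
      forall A B : borel, A `&` B = set0 -> P (borelU A B) = P A + P B].

Definition countably_additive P : Prop :=
  forall F : nat -> borel, trivIset setT (fun n => F n : set Omega) ->
    series (fun n => P (F n)) @ \oo --> P (borel_bigcup F).

Definition merely_finitely_additive P : Prop :=
  probability_function P /\ ~ countably_additive P.

Definition positive_on_cylinders P : Prop :=
  forall (w : Omega) (n : nat), (0 < n)%N -> 0 < P (borel_cyl w n).

(* Only meaningful when P is positive on cylinders (x / 0 = 0 otherwise). *)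
Definition posterior P (n : nat) (A : borel) (w : Omega) : R :=
  P (borelI A (borel_cyl w n)) / P (borel_cyl w n).

Definition converges_to_truth_almost_uniformly P : Prop :=
  forall (A : borel) (eps : R), 0 < eps ->
    exists2 E : borel, P E < eps &
      forall r : R, 0 < r ->
        exists2 N : nat, (0 < N)%N &
          forall (n : nat) (w : Omega), (N <= n)%N -> ~ bset E w ->
            `|posterior P n A w - \1_(bset A) w| < r.

End probability_functions.

Definition free_ultrafilter (U : set_system nat) : Prop :=
  UltraFilter U /\ forall A : set nat, finite_set A -> ~ U A.

Section construction.
Variable R : realType.

Definition dpath (k : nat) : Omega := fun i => i == k.

Definition shift_path (k : nat) (x : Omega) : Omega :=
  fun i => if (i < k)%N then false else if i == k then true else x (i - k.+1)%N.

Definition nu (k : nat) : set Omega -> \bar R :=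
  pushforward (fair_coin R) (shift_path k).

Definition tweight (k : nat) : R := 2^-1 ^+ k.+1.

Definition R0 (theta : nat -> R) (A : set Omega) : \bar R :=
  (\sum_(0 <= k <oo) (tweight k)%:E *
     ((1 - theta k)%:E * \d_(dpath k) A + (theta k)%:E * nu k A))%E.

Definition ulim (U : set_system nat) (A : set Omega) : R :=
  if `[< U [set k | A (dpath k)] >] then 1 else 0.

(* R0 theta takes its values in [0, 1] when 0 <= theta <= 1, so fine loses
   nothing. *)
Definition Pmix (U : set_system nat) (theta : nat -> R) (alpha : R)
    (A : borel) : R :=
  alpha * ulim U A + (1 - alpha) * fine (R0 theta A).

End construction.

(* Main.v *)
(* Write C_k for the cylinder of the prefix 0^k 1 (indices from 0).  These
   cylinders partition Omega minus the zero path; u vanishes on every C_k and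
   gives mass 1 to their union, so countable additivity fails.

   For truth-tracking, fix A and remove a small set.  On finitely many C_k the
   measure u is invisible to the posteriors, which are those of the countably
   additive R_0, and Levy's zero-one law applies; its almost uniform form comes
   from approximating A by clopen sets and the maximal inequality.  From the
   remaining tail cylinder keep only the points d_k at which 1_A agrees with
   u(A): the removed part has small R_0-mass and u-mass 0.  At such a d_k the
   posteriors are close to u(A) for n <= k because u dominates, and for n > k
   they err by at most theta_k / (1 - theta_k); theta_k -> 0 makes this uniform
   in k. *)
From HB Require Import structures.
Require Import Defs.
From mathcomp Require Import all_boot all_order all_algebra.
From mathcomp Require Import all_classical all_reals all_analysis.
From mathcomp Require Import ring lra zify.

Import Order.TTheory GRing.Theory Num.Theory.
Import numFieldNormedType.Exports.

Local Open Scope classical_set_scope.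
Local Open Scope ring_scope.

Set Implicit Arguments.
Unset Strict Implicit.

(** * Cylinders and measures of Borel sets *)

Lemma cylxx (w : Omega) n : cyl w n w. Proof. by []. Qed.

Lemma cyl_eq (v w : Omega) n : cyl w n v -> cyl v n = cyl w n.
Proof.
move=> vw; apply/seteqP; split=> x h i ni; first by rewrite h// vw.
by rewrite h// vw.
Qed.

Lemma cyl_le (w : Omega) m n : (m <= n)%N -> cyl w n `<=` cyl w m.
Proof. by move=> mn x h i im; apply: h; exact: leq_trans mn. Qed.

(** Finite bit sequences code all cylinders, so [B] is a countable union of cylinders contained in
    it. *)
Lemma measurable_cyl_open (B : set Omega) :
  (forall x, B x -> exists n, cyl x n `<=` B) -> measurable B.
Proof.
move=> oB.
pose F (s : seq bool) : set Omega :=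
  if `[< cyl (nth false s) (size s) `<=` B >] then cyl (nth false s) (size s)
  else set0.
rewrite (_ : B = \bigcup_s F s).
  apply: countable_bigcupT_measurable => // s.
  by rewrite /F; case: ifP => // _; exact: measurable_cyl.
apply/seteqP; split=> [x Bx|x [s _]]; last first.
  by rewrite /F; case: asboolP => // sB; exact: sB.
have [n nB] := oB x Bx.
exists (mkseq x n) => //.
have sx : cyl x n (nth false (mkseq x n)) by move=> i ni; rewrite nth_mkseq.
by rewrite /F size_mkseq -(cyl_eq sx) in nB *; case: asboolP => // _; rewrite (cyl_eq sx).
Qed.

(** These are the unions of cylinders of length [n]; over all [n] they give the clopen sets. *)
Definition prefix_determined (n : nat) (B : set Omega) : Prop :=
  forall x, B x -> cyl x n `<=` B.

Lemma prefix_determined_measurable n B : prefix_determined n B -> measurable B.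
Proof. by move=> dB; apply: measurable_cyl_open => x /dB; exists n. Qed.

Lemma prefix_determined_le m n B :
  (m <= n)%N -> prefix_determined m B -> prefix_determined n B.
Proof. by move=> mn dB x Bx; apply: subset_trans (dB x Bx); exact: cyl_le. Qed.

Lemma prefix_determinedC n B : prefix_determined n B -> prefix_determined n (~` B).
Proof.
by move=> dB x nBx y xy By; apply: nBx; apply: (dB y) => //; rewrite (cyl_eq xy).
Qed.

Lemma prefix_determinedU n A B :
  prefix_determined n A -> prefix_determined n B -> prefix_determined n (A `|` B).
Proof.
by move=> dA dB x [/dA h|/dB h] y /h; [left|right].
Qed.

Section finite_real_measure.
Context {R : realType} (mu : probability Omega R).
Implicit Types A B C : set Omega.

(** Real values open the way to ring and order tactics; on measurable sets [fine] loses nothing, as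
    [mu] is finite. *)
Definition prob A : R := fine (mu A).

Lemma probE A : measurable A -> mu A = (prob A)%:E.
Proof. by move=> mA; rewrite /prob fineK// fin_num_measure. Qed.

Lemma prob_ge0 A : 0 <= prob A.
Proof. exact/fine_ge0/measure_ge0. Qed.

Lemma prob0 : prob set0 = 0. Proof. by rewrite /prob measure0. Qed.

Lemma probT : prob setT = 1. Proof. by rewrite /prob probability_setT. Qed.

Lemma prob_le A B : measurable A -> measurable B -> A `<=` B -> prob A <= prob B.
Proof.
by move=> mA mB AB; rewrite -lee_fin -!probE//; apply: le_measure; rewrite ?inE.
Qed.

Lemma probU A B : measurable A -> measurable B -> A `&` B = set0 ->
  prob (A `|` B) = prob A + prob B.
Proof.
move=> mA mB AB; apply: EFin_inj; rewrite EFinD -!probE//; last exact: measurableU.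
exact: measureU.
Qed.

Lemma probID A B : measurable A -> measurable B ->
  prob A = prob (A `&` B) + prob (A `\` B).
Proof.
move=> mA mB; rewrite -probU; first by rewrite -setIUr setUv setIT.
- exact: measurableI.
- exact: measurableD.
- by rewrite setDE setIACA setICr setI0.
Qed.

Lemma probU_le A B : measurable A -> measurable B -> prob (A `|` B) <= prob A + prob B.
Proof.
move=> mA mB; rewrite (@probID (A `|` B) A)//; last exact: measurableU.
rewrite setIidr; last exact: subsetUl.
rewrite lerD2l; apply: prob_le => //; last by move=> x [[]].
by apply: measurableD => //; exact: measurableU.
Qed.

Lemma prob_bigcup_cvg (F : nat -> set Omega) : (forall n, measurable (F n)) ->
  {homo F : m n / (m <= n)%N >-> m `<=` n} ->
  prob (F n) @[n --> \oo] --> prob (\bigcup_n F n).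
Proof.
move=> mF hF; have mU : measurable (\bigcup_n F n) by exact: bigcupT_measurable.
apply: fine_cvg; rewrite -probE//; apply: nondecreasing_cvg_mu => // m n mn.
by apply/subsetPset; exact: hF.
Qed.

Lemma prob_bigcap_cvg (F : nat -> set Omega) : (forall n, measurable (F n)) ->
  {homo F : m n / (n <= m)%N >-> m `<=` n} ->
  prob (F n) @[n --> \oo] --> prob (\bigcap_n F n).
Proof.
move=> mF hF; have mU : measurable (\bigcap_n F n) by exact: bigcapT_measurable.
apply: fine_cvg; rewrite -probE//; apply: nonincreasing_cvg_mu => //.
  by rewrite ltey_eq fin_num_measure.
by move=> m n mn; apply/subsetPset; exact: hF.
Qed.

Lemma prob_bigcup_le (F : nat -> set Omega) (e : R) :
  (forall n, measurable (F n)) -> 0 <= e ->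
  (forall n, prob (F n) <= e / (2 ^ n.+1)%:R) -> prob (\bigcup_n F n) <= e.
Proof.
move=> mF e0 h; have mU : measurable (\bigcup_n F n) by exact: bigcupT_measurable.
rewrite -lee_fin -probE//.
apply: le_trans (epsilon_trick0 xpredT e0).
apply: le_trans (@measure_sigma_subadditive _ _ _ mu _ _ mF mU (@subset_refl _ _)) _.
by apply: lee_nneseries => // n _; have := h n; rewrite -lee_fin -probE.
Qed.

(** If x is in A the error is the mass of C outside A, otherwise it is the mass of C inside A; both
    sets lie in D. The lemma serves Levy's law as well as the atoms d_k. *)
Lemma prob_cond_err A C D x : measurable A -> measurable C -> measurable D ->
  (forall y, C y -> ~ D y -> (A y <-> A x)) ->
  `|prob (A `&` C) - \1_A x * prob C| <= prob (C `&` D).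
Proof.
move=> mA mC mD AD; have mCD := measurableI _ _ mC mD.
have [Ax|nAx] := pselect (A x).
  rewrite indicE mem_set// mul1r distrC (probID mC mA) setIC addrAC subrr add0r.
  rewrite ger0_norm ?prob_ge0//; apply: prob_le => //; first exact: measurableD.
  move=> y [Cy nAy]; split => //; apply: contrapT => nDy.
  by apply: nAy; apply/(AD y).
rewrite indicE memNset// mul0r subr0 ger0_norm ?prob_ge0//; apply: prob_le => //.
  exact: measurableI.
move=> y [Ay Cy]; split => //; apply: contrapT => nDy.
by apply: nAx; apply/(AD y).
Qed.

End finite_real_measure.

(** * Levy's zero-one law *)

Section levy_zero_one_law.
Context {R : realType} (mu : probability Omega R).
Implicit Types A B C D : set Omega.

Local Notation pr := (prob mu).

Definition symdiff A B := (A `\` B) `|` (B `\` A).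

Lemma measurable_symdiff A B :
  measurable A -> measurable B -> measurable (symdiff A B).
Proof. by move=> mA mB; apply: measurableU; exact: measurableD. Qed.

(** Measurability is built in so that these sets form a sigma-algebra on which continuity of [mu] is
    available. *)
Definition clopen_approximable A : Prop :=
  measurable A /\ forall e : R, 0 < e -> exists n, exists2 B,
    prefix_determined n B & pr (symdiff A B) < e.

Lemma clopen_approximable_determined n A :
  prefix_determined n A -> clopen_approximable A.
Proof.
move=> dA; split; first exact: prefix_determined_measurable dA.
by move=> e e0; exists n, A => //; rewrite /symdiff setDv setU0 prob0.
Qed.

Lemma clopen_approximableC A :
  clopen_approximable A -> clopen_approximable (~` A).
Proof.
move=> [mA h]; split; first exact: measurableC.
move=> e /h[n [B dB AB]]; exists n, (~` B); first exact: prefix_determinedC.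
suff <- : symdiff A B = symdiff (~` A) (~` B) by [].
by rewrite /symdiff !setDE !setCK setUC (setIC A) (setIC B).
Qed.

Lemma clopen_approximableU A B :
  clopen_approximable A -> clopen_approximable B -> clopen_approximable (A `|` B).
Proof.
move=> [mA hA] [mB hB]; split; first exact: measurableU.
move=> e e0; have e20 : 0 < e / 2 by rewrite divr_gt0.
have [n [C dC AC]] := hA _ e20; have [m [D dD BD]] := hB _ e20.
exists (maxn n m), (C `|` D).
  apply: prefix_determinedU.
    by apply: prefix_determined_le dC; exact: leq_maxl.
  by apply: prefix_determined_le dD; exact: leq_maxr.
have mC := prefix_determined_measurable dC.
have mD := prefix_determined_measurable dD.
have mAC := measurable_symdiff mA mC.
have mBD := measurable_symdiff mB mD.
rewrite (splitr e).
apply: le_lt_trans (ltrD AC BD); apply: le_trans (probU_le mu mAC mBD).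
apply: prob_le; [|exact: measurableU|].
  by apply: measurable_symdiff; exact: measurableU.
rewrite /symdiff => x.
by case=> -[[] + /not_orP[]]; [left;left|right;left|left;right|right;right].
Qed.

(** Half of the error goes to replacing the union by some [F N], by continuity from below, the other
    half to approximating [F N]. *)
Lemma clopen_approximable_lim (F : nat -> set Omega) :
  (forall n, clopen_approximable (F n)) ->
  {homo F : m n / (m <= n)%N >-> m `<=` n} ->
  clopen_approximable (\bigcup_n F n).
Proof.
move=> aF hF; have mF n : measurable (F n) by case: (aF n).
have mU : measurable (\bigcup_n F n) by exact: bigcupT_measurable.
split=> // e e0; have e20 : 0 < e / 2 by rewrite divr_gt0.
have /cvgrPdist_lt h := prob_bigcup_cvg (mu := mu) mF hF.
have [N _ /(_ N (leqnn N))] := h _ e20.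
rewrite /= => /ltr_normlW UN.
have {}UN : pr (\bigcup_n F n `\` F N) < e / 2.
  move: UN; rewrite (probID mu mU (mF N)) (@setIidr _ (\bigcup_n F n) (F N)) 1?addrC ?addKr//.
  exact: bigcup_sup.
have [n [B dB FB]] := (aF N).2 _ e20; exists n, B => //.
have mB := prefix_determined_measurable dB.
rewrite (splitr e).
have mFB := measurable_symdiff (mF N) mB.
have mUF := measurableD mU (mF N).
apply: le_lt_trans (ltrD UN FB); apply: le_trans (probU_le mu mUF mFB).
apply: prob_le; [exact: measurable_symdiff|exact: measurableU|].
move=> x [[Ux nBx]|[Bx nUx]]; have [FNx|nFNx] := pselect (F N x).
- by right; left.
- by left.
- by case: nUx; exists N.
- by right; right.
Qed.

(** An open set U is the increasing union over n of the clopen sets of points whose cylinder of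
    length n lies in U; the approximable sets form a sigma-algebra. *)
Lemma borel_clopen_approximable A : measurable A -> clopen_approximable A.
Proof.
suff: <<s @open cantor_space >> `<=` clopen_approximable by apply.
apply: smallest_sub; last first.
  move=> U oU; pose F n : set Omega := [set x | cyl x n `<=` U].
  have dF n : prefix_determined n (F n).
    by move=> x Fx y xy z; rewrite (cyl_eq xy); exact: Fx.
  rewrite (_ : U = \bigcup_n F n).
    apply: clopen_approximable_lim => [n|m n mn x].
      exact: clopen_approximable_determined (dF n).
    by rewrite /F/= => Fx y xy; apply: Fx; exact: cyl_le xy.
  apply/seteqP; split=> [x Ux|x [n _]]; last by apply; exact: cylxx.
  by have [n nU] := open_cyl oU Ux; exists n.
split.
- apply: (@clopen_approximable_determined 0) => x; exact.
- by move=> B hB; rewrite setTD; exact: clopen_approximableC.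
(* Passing to finite partial unions makes the sequence increasing. *)
- move=> F aF; rewrite -bigcup_bigsetU_bigcup.
  apply: clopen_approximable_lim => [n|m n mn].
    elim: n.+1 => [|k ih]; last first.
      by rewrite big_ord_recr; exact: clopen_approximableU.
    by rewrite big_ord0; apply: (@clopen_approximable_determined 0) => x; exact.
  by apply: subset_bigsetU; rewrite ltnS.
Qed.

(** The conditional probability of [D] passes [r] at some time from [k] to [k + d]. The product form
    stays meaningful on null cylinders. *)
Definition exceeds D (r : R) k d : set Omega := [set x |
  exists2 m, (k <= m <= k + d)%N & r * pr (cyl x m) < pr (D `&` cyl x m)].

Lemma exceeds_determined D r k d : prefix_determined (k + d) (exceeds D r k d).
Proof.
move=> x [m /andP[km md] h] y xy; exists m; first by rewrite km.
by rewrite (@cyl_eq y x)//; exact: cyl_le xy.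
Qed.

Definition with_bit (w : Omega) n (b : bool) : Omega :=
  fun i => if i == n then b else w i.

Lemma cylS w n :
  cyl w n = cyl (with_bit w n true) n.+1 `|` cyl (with_bit w n false) n.+1.
Proof.
apply/seteqP; split=> x.
  move=> h; case xn : (x n); [left|right] => i; rewrite ltnS leq_eqVlt;
    rewrite /with_bit; by case: eqVneq => [->|_ /h].
by move=> [] h i ni; rewrite h 1?ltnW ?ltnS// /with_bit ltn_eqF.
Qed.

Lemma cylS_disj w n :
  cyl (with_bit w n true) n.+1 `&` cyl (with_bit w n false) n.+1 = set0.
Proof.
rewrite -subset0 => x [/(_ n (ltnSn n)) + /(_ n (ltnSn n))].
by rewrite /with_bit eqxx => ->.
Qed.

Lemma prob_cylS A w n : measurable A ->
  pr (A `&` cyl w n) = pr (A `&` cyl (with_bit w n true) n.+1) +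
                       pr (A `&` cyl (with_bit w n false) n.+1).
Proof.
move=> mA; rewrite cylS setIUr probU//; try
  by apply: measurableI => //; exact: measurable_cyl.
by rewrite setIACA cylS_disj setI0.
Qed.

(** Doob's inequality for the martingale of conditional probabilities, by induction on the horizon
    [d]: a crossing at level [k] settles the whole cylinder, and otherwise the bounds for its two
    halves add up. *)
Lemma maximal_inequality_local D r d : measurable D -> 0 <= r -> forall k w,
  r * pr (exceeds D r k d `&` cyl w k) <= pr (D `&` cyl w k).
Proof.
move=> mD r0; have mE k d' : measurable (exceeds D r k d').
  exact: prefix_determined_measurable (@exceeds_determined D r k d').
elim: d => [|d ih] k w.
  have [h|h] := ltP (r * pr (cyl w k)) (pr (D `&` cyl w k)).
    apply: le_trans (ltW h); apply: ler_wpM2l => //; apply: prob_le => //.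
      by apply: measurableI => //; exact: measurable_cyl.
    exact: measurable_cyl.
  rewrite (_ : _ `&` _ = set0) ?prob0 ?mulr0 ?prob_ge0// -subset0.
  move=> x [[m]]; rewrite addn0 -eqn_leq => /eqP <- + wx.
  by rewrite (cyl_eq wx) ltNge h.
have [h|h] := ltP (r * pr (cyl w k)) (pr (D `&` cyl w k)).
  apply: le_trans (ltW h); apply: ler_wpM2l => //; apply: prob_le => //.
    by apply: measurableI => //; exact: measurable_cyl.
  exact: measurable_cyl.
rewrite (prob_cylS w k mD).
apply: le_trans (lerD (ih _ _) (ih _ _)); rewrite -mulrDr -prob_cylS//.
apply: ler_wpM2l => //; apply: prob_le.
- by apply: measurableI => //; exact: measurable_cyl.
- by apply: measurableI => //; exact: measurable_cyl.
(* By [h] there is no crossing at level [k], so the level [m] is at least [k + 1]. *)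
- move=> x [[m /andP[km md] mx] wx]; split => //; exists m => //.
  rewrite addSnnS md andbT ltn_neqAle km andbT.
  by apply: contraTneq mx => <-; rewrite (cyl_eq wx) -leNgt.
Qed.

(** The local inequality on the cylinder of length 0, which is the whole space, with the horizon
    sent to infinity. *)
Lemma maximal_inequality D r : measurable D -> 0 <= r ->
  let E := [set x | exists m, r * pr (cyl x m) < pr (D `&` cyl x m)] in
  measurable E /\ r * pr E <= pr D.
Proof.
move=> mD r0 E; have mE d : measurable (exceeds D r 0 d).
  exact: prefix_determined_measurable (@exceeds_determined D r 0 d).
have -> : E = \bigcup_d exceeds D r 0 d.
  apply/seteqP; split=> [x [m h]|x [d _ [m _ h]]]; last by exists m.
  by exists m => //; exists m; rewrite ?add0n ?leqnn.
split; first exact: bigcupT_measurable.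
have hE : {homo exceeds D r 0 : m n / (m <= n)%N >-> m `<=` n}.
  move=> m n mn x [k /= km h]; exists k => //=.
  by move: km; rewrite !add0n => km; exact: leq_trans mn.
have c : r * pr (exceeds D r 0 d) @[d --> \oo] --> r * pr (\bigcup_d exceeds D r 0 d).
  by apply: cvgMr; exact: prob_bigcup_cvg.
apply: (ler_cvg_to c (cvg_cst (pr D))).
apply: nearW => d; have := @maximal_inequality_local D r d mD r0 0 point.
have -> : cyl point 0 = setT by apply/seteqP; split.
by rewrite !setIT.
Qed.

(* If B is determined by the first n coordinates and D = symdiff A B, then for
   m >= n the error at a point x outside D is at most mu (D & cyl x m). *)
Lemma levy_almost_uniform A (e : R) : measurable A -> 0 < e ->
  exists E, [/\ measurable E, pr E <= e & forall r : R, 0 < r ->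
    exists N, forall n x, (N <= n)%N -> ~ E x ->
      `|pr (A `&` cyl x n) - \1_A x * pr (cyl x n)| <= r * pr (cyl x n)].
Proof.
move=> mA e0; pose t j : R := j.+1%:R^-1.
(* [t j] is the tolerance on posteriors. With approximation error [d j], the maximal inequality
   gives [M j] mass at most e / 2^(j+2); since [t j] is at most 1 the symmetric difference obeys the
   same bound, and the total is at most [e]. *)
pose d j : R := t j * (e / (2 ^ j.+2)%:R).
have t0 j : 0 < t j by rewrite invr_gt0.
have d0 j : 0 < d j by rewrite mulr_gt0// divr_gt0// ltr0n expn_gt0.
have /choice[B hB] : forall j, exists B,
    (exists n, prefix_determined n B) /\ pr (symdiff A B) < d j.
  by move=> j; have [n [B dB]] := (borel_clopen_approximable mA).2 _ (d0 j);
    exists B; split => //; exists n.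
have mB j : measurable (B j).
  by have [[n /prefix_determined_measurable]] := hB j.
have mD j := measurable_symdiff mA (mB j).
pose M j : set Omega :=
  [set x | exists m, t j * pr (cyl x m) < pr (symdiff A (B j) `&` cyl x m)].
have max j : measurable (M j) /\ t j * pr (M j) <= pr (symdiff A (B j)).
  exact: maximal_inequality (mD j) (ltW (t0 j)).
exists (\bigcup_j (M j `|` symdiff A (B j))); split.
- apply: bigcupT_measurable => j; apply: measurableU => //; exact: (max j).1.
- apply: prob_bigcup_le (ltW e0) _ => j.
    by apply: measurableU => //; exact: (max j).1.
  apply: le_trans (probU_le mu (max j).1 (mD j)) _.
  have -> : e / (2 ^ j.+1)%:R = e / (2 ^ j.+2)%:R + e / (2 ^ j.+2)%:R.
    rewrite (expnS _ j.+1) natrM; field.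
    by rewrite pnatr_eq0 -lt0n expn_gt0.
  have hd := (hB j).2; apply: lerD.
    rewrite -(ler_pM2l (t0 j)); apply: le_trans (max j).2 _; exact: ltW.
  apply: le_trans (ltW hd) _; rewrite /d ler_piMl//.
    by rewrite divr_ge0// ltW.
  by rewrite invf_le1// ler1n.
(* This [j] satisfies 1 / (j + 1) <= r. *)
- move=> r r0; pose j := Num.truncn r^-1.
  have tr : t j <= r.
    by rewrite invf_ple ?posrE//; apply/ltW/truncnS_gt.
  have [[N dB] _] := hB j; exists N => n x Nn nE.
  have nM : ~ M j x by move=> ?; apply: nE; exists j => //; left.
  have nD : ~ symdiff A (B j) x by move=> ?; apply: nE; exists j => //; right.
  have mc := measurable_cyl x n.
  apply: le_trans (_ : pr (symdiff A (B j) `&` cyl x n) <= _); last first.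
    apply: le_trans (_ : t j * pr (cyl x n) <= _).
      by rewrite leNgt; apply/negP => h; apply: nM; exists n.
    by rewrite ler_wpM2r// prob_ge0.
  rewrite (setIC (symdiff _ _)); apply: prob_cond_err => // y xy nDy.
  have BA z : ~ symdiff A (B j) z -> (A z <-> B j z).
    by move=> nDz; split => ?; apply: contrapT => ?; apply: nDz; [left|right].
  have xyN : cyl x N y by exact: cyl_le xy.
  rewrite !BA//; split=> [By|Bx]; last exact: dB Bx _ xyN.
  by apply: dB By _ _; rewrite (cyl_eq xyN).
Qed.

End levy_zero_one_law.

(** * The measure R_0 *)

(** The map is continuous: the first n bits of the input determine the first n bits of the
    output. *)
Lemma measurable_shift_path k : measurable_fun [set: Omega] (shift_path k).
Proof.
apply: measurability => // _ [U oU <-]; rewrite setTI.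
apply: measurable_cyl_open => x Ux; have [n nU] := open_cyl oU Ux.
exists n => y xy; apply: nU => i ni; rewrite /shift_path.
by do 2 case: ifP => // _; rewrite xy// (leq_ltn_trans (leq_subr _ _)).
Qed.

HB.instance Definition _ k :=
  isMeasurableFun.Build _ _ _ _ (shift_path k) (measurable_shift_path k).

Section R0_probability.
Context {R : realType} (theta : nat -> R).
Hypothesis theta01 : forall k, 0 < theta k < 1.

Let theta_ge0 k : 0 <= theta k.
Proof. by have /andP[/ltW] := theta01 k. Qed.

Let onem_theta_ge0 k : 0 <= 1 - theta k.
Proof. by have /andP[_ /ltW] := theta01 k; rewrite subr_ge0. Qed.

Let tweight_ge0 k : 0 <= tweight R k.
Proof. by rewrite /tweight exprn_ge0// invr_ge0. Qed.

(** The k-th term of the series [R0] as a bundled measure, so that countable additivity comes from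
    [mseries]. *)
Let branch k : {measure set Omega -> \bar R} :=
  mscale (NngNum (tweight_ge0 k))
    (measure_add (mscale (NngNum (onem_theta_ge0 k)) \d_(dpath k))
       (mscale (NngNum (theta_ge0 k))
          (distribution (fair_coin R) (shift_path k)))).

Let mix := mseries branch 0.

Let mixE A : mix A = R0 theta A.
Proof.
rewrite /mix/mseries/R0; apply: eq_eseriesr => k _.
exact: (congr1 (mule (tweight R k)%:E) (measure_addE _ _ A)).
Qed.

(** Each branch is a convex combination of probabilities, which leaves the geometric series of the
    weights. *)
Lemma R0T : R0 theta [set: Omega] = 1%E.
Proof.
rewrite /R0 (_ : (fun n => _) = eseries (fun k => (1 / (2 ^ (k + 1))%:R)%:E)).
  have /cvg_lim -> // := @cvg_geometric_eseries_half R 1 0.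
  by rewrite expr0 divr1.
apply/funext => n; rewrite /eseries /= !big_mkord; apply: eq_bigr => k _.
rewrite diracT /nu /pushforward preimage_setT probability_setT !mule1 -EFinD.
by rewrite subrK mule1 /tweight addn1 natrX exprVn mul1r.
Qed.

HB.instance Definition _ := Measure.on mix.

Let mixT : mix setT = 1%E. Proof. by rewrite mixE R0T. Qed.

HB.instance Definition _ := Measure_isProbability.Build _ _ _ mix mixT.

Lemma R0_probability :
  exists mu : probability Omega R, forall A, mu A = R0 theta A.
Proof. by exists mix => A; exact: mixE. Qed.

End R0_probability.


(** * The partition by the position of the first 1 *)

Lemma dpathP k n : cyl (dpath k) k.+1 `<=` [set w : Omega | w n -> (k <= n)%N].
Proof.
move=> w h /= wn; rewrite leqNgt; apply/negP => nk.
by move: wn; rewrite h ?ltnS 1?ltnW// /dpath ltn_eqF.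
Qed.

(** Both indices are the position of the first 1 of [w]. *)
Lemma cyl_dpath_inj j k (w : Omega) :
  cyl (dpath j) j.+1 w -> cyl (dpath k) k.+1 w -> j = k.
Proof.
move=> wj wk; apply/eqP; rewrite eqn_leq.
rewrite (dpathP wj) /=; last by rewrite wk // /dpath eqxx.
by apply: (dpathP wk); rewrite wj // /dpath eqxx.
Qed.

Lemma shift_path_cyl k x : cyl (dpath k) k.+1 (shift_path k x).
Proof.
move=> i; rewrite ltnS leq_eqVlt /shift_path /dpath => /predU1P[->|ik].
  by rewrite ltnn eqxx.
by rewrite ik ltn_eqF.
Qed.

Lemma cyl_first_one (w : Omega) n : ~ cyl (fun=> false) n w ->
  exists2 k, (k < n)%N & cyl (dpath k) k.+1 w.
Proof.
move=> h; have /existsNP[i /not_implyP[lin /eqP wi]] := h.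
have {h} ex : exists i, w i by exists i; move: wi; case: (w i).
case: (ex_minnP ex) => k wk kmin; exists k.
  by apply: leq_ltn_trans lin; apply: kmin; move: wi; case: (w i).
move=> j; rewrite ltnS leq_eqVlt /dpath => /predU1P[->|jk]; first by rewrite eqxx.
by rewrite ltn_eqF//; apply: contraTF jk => /kmin; rewrite -leqNgt.
Qed.

Lemma cyl_dpath_zero k n : (n <= k)%N -> cyl (fun=> false) n (dpath k).
Proof. by move=> nk i lin; rewrite /dpath ltn_eqF// (leq_trans lin). Qed.

(** This transports positivity of the fair coin on cylinders to R_0. *)
Lemma cyl_sub_branch (w : Omega) n :
  exists k x m, cyl x m `<=` shift_path k @^-1` cyl w n.
Proof.
have [w0|/cyl_first_one[k kn wk]] := pselect (cyl (fun=> false) n w).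
  (* If the prefix is all zeros, T_n maps every input into the cylinder; otherwise k below is the
     position of the first 1 and the later bits of [w] are prescribed. *)
  by exists n, point, 0%N => x _ i lin; rewrite /shift_path lin w0.
exists k, (fun i => w (i + k.+1)%N), n => x h i lin; rewrite /shift_path.
case: ltngtP => ik.
- by rewrite wk /dpath ?ltn_eqF// ltnS ltnW.
- by rewrite h ?subnK// (leq_ltn_trans (leq_subr _ _)).
- by rewrite ik wk // /dpath eqxx.
Qed.

Lemma measurable_set1_Omega (w : Omega) : measurable [set w].
Proof.
rewrite (_ : [set w] = [set x | forall i, setT i -> [set w i] (x i)]).
  exact: (measurable_rect [set: nat] (fun i => [set w i])).
by apply/seteqP; split=> x /=; [move=> ->|move=> h; apply/funext => i; exact: (h i Logic.I)].
Qed.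

Section R0_values.
Context {R : realType} (theta : nat -> R).
Hypothesis theta01 : forall k, 0 < theta k < 1.

(** The measures of index j live on C_j, and these cylinders are disjoint, so only the k-th term
    survives. *)
Lemma R0_on_branch k (A : set Omega) : A `<=` cyl (dpath k) k.+1 ->
  R0 theta A = ((tweight R k)%:E *
    ((1 - theta k)%:E * \d_(dpath k) A + (theta k)%:E * nu R k A))%E.
Proof.
move=> Ak; rewrite /R0 (@nneseriesD1 _ _ k)//; last first.
  move=> j _; have /andP[t0 t1] := theta01 j.
  have tw : 0 <= tweight R j by rewrite /tweight exprn_ge0// invr_ge0.
  apply: mule_ge0; first by rewrite lee_fin.
  apply: adde_ge0; apply: mule_ge0;
    by [rewrite lee_fin ?subr_ge0 ltW|exact: measure_ge0].
rewrite [X in (_ + X)%E]eseries0 ?adde0// => j _ /= jk.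
have nA w : cyl (dpath j) j.+1 w -> ~ A w.
  by move=> wj /Ak wk; move: jk; rewrite (cyl_dpath_inj wj wk) eqxx.
rewrite diracE memNset; last exact: nA.
rewrite /nu /pushforward (_ : _ @^-1` A = set0) ?measure0 ?mule0 ?adde0 ?mule0//.
by rewrite -subset0 => x /=; apply: nA; exact: shift_path_cyl.
Qed.

(** The path d_k and every value of T_k carry a 1 at index k. Hence cylinders around the zero path
    have vanishing R_0-mass. *)
Lemma R0_zero : R0 theta [set (fun=> false) : Omega] = 0%E.
Proof.
rewrite /R0 eseries0 // => k _ _.
rewrite diracE memNset /=; last first.
  by move=> /(congr1 (fun w : Omega => w k)); rewrite /dpath eqxx.
rewrite /nu /pushforward (_ : _ @^-1` _ = set0) ?measure0 ?mule0 ?adde0 ?mule0//.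
rewrite -subset0 => x /= /(congr1 (fun w : Omega => w k)).
by rewrite /shift_path ltnn eqxx.
Qed.

Lemma fair_coin_cyl_gt0 (w : Omega) n : (0 < fair_coin R (cyl w n))%E.
Proof.
rewrite (fair_coinP R n (fun i => [set w i])).
have h01 : 0 <= (2^-1 : R) <= 1 by rewrite invr_ge0 ler0n invf_le1 ?ler1n ?ltr0n.
elim/big_ind: _ => //; first exact: mule_gt0.
move=> i _; rewrite bernoulli_probE// !diracE -!EFinM -EFinD lte_fin.
have E : unstable.onem (2^-1 : R) = 2^-1 by rewrite /unstable.onem; lra.
rewrite E -mulrDr mulr_gt0 ?invr_gt0//.
have inb (a b : bool) : (a \in [set b]%classic) = (a == b) by apply/idP/eqP; rewrite inE.
by rewrite !inb; case: (w i); rewrite /= ?addr0 ?add0r.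
Qed.

(** Some T_k sends a whole cylinder into the given one, and its coin part has weight t_k theta_k >
    0. *)
Lemma R0_cyl_gt0 (w : Omega) n : (0 < R0 theta (cyl w n))%E.
Proof.
have [mu muE] := R0_probability theta01; rewrite -muE.
have [k [x [m h]]] := cyl_sub_branch w n.
have mc := measurable_cyl w n; have mk := measurable_cyl (dpath k) k.+1.
apply: (@lt_le_trans _ _ (mu (cyl w n `&` cyl (dpath k) k.+1))); last first.
  by apply: le_measure; rewrite ?inE//; exact: measurableI.
have /andP[t0 t1] := theta01 k.
rewrite muE (@R0_on_branch k); last exact: subIsetr.
apply: mule_gt0; first by rewrite lte_fin /tweight exprn_gt0// invr_gt0.
apply: lt_le_trans (leeDr _ _); last first.
  by rewrite mule_ge0// lee_fin subr_ge0 ltW.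
rewrite mule_gt0// ?lte_fin//.
apply: lt_le_trans (fair_coin_cyl_gt0 x m) _.
rewrite /nu /pushforward; apply: le_measure; rewrite ?inE.
- exact: measurable_cyl.
- rewrite -[X in measurable X]setTI; apply: measurable_shift_path => //.
  exact: measurableI.
- by move=> y /h yw; split => //; exact: shift_path_cyl.
Qed.

End R0_values.

(** * The ultrafilter mixture *)

Section ulim.
Context (R : realType) {U : set_system nat}.
Hypothesis freeU : free_ultrafilter U.

Let ultraU : UltraFilter U. Proof. by case: freeU. Qed.
Let properU : ProperFilter U. Proof. exact: ultra_proper. Qed.
Let filterU : Filter U. Proof. exact: filter_filter. Qed.
#[local] Existing Instance filterU.

Lemma free_ultrafilter_ge N : U [set k | (N <= k)%N].
Proof.
have [//|UN] := @in_ultra_setVsetC _ U [set k | (N <= k)%N] ultraU.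
case: (freeU.2 (~` [set k | (N <= k)%N])) => //.
apply: (@sub_finite_set _ _ `I_N); last exact: finite_II.
by move=> k /= /negP; rewrite -ltnNge.
Qed.

Lemma ulim1 (A : set Omega) : U [set k | A (dpath k)] -> ulim R U A = 1.
Proof. by rewrite /ulim; case: asboolP. Qed.

Lemma ulim_all (A : set Omega) : (forall k, A (dpath k)) -> ulim R U A = 1.
Proof. by move=> dA; apply: ulim1; exact: filterE. Qed.

Lemma ulim0 (A : set Omega) : U [set k | ~ A (dpath k)] -> ulim R U A = 0.
Proof.
move=> UnA; rewrite /ulim; case: asboolP => // UA.
by have [k []] := @filter_ex _ _ properU _ (filterI UA UnA).
Qed.

Lemma ulim_ge0 (A : set Omega) : 0 <= ulim R U A.
Proof. by rewrite /ulim; case: ifP. Qed.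

Lemma ulim_le1 (A : set Omega) : ulim R U A <= 1.
Proof. by rewrite /ulim; case: ifP. Qed.

Lemma ulimU (A B : set Omega) : A `&` B = set0 ->
  ulim R U (A `|` B) = ulim R U A + ulim R U B.
Proof.
move=> AB.
have [UA|UA] := in_ultra_setVsetC [set k | A (dpath k)] ultraU.
  rewrite (ulim1 UA) ulim1 ?ulim0 ?addr0//; apply: filterS UA => k Ak /=.
    by move=> Bk; have : (A `&` B) (dpath k) by []; rewrite AB.
  by left.
rewrite (ulim0 UA) add0r.
have [UB|UB] := in_ultra_setVsetC [set k | B (dpath k)] ultraU.
  by rewrite !ulim1//; apply: filterS UB => k; right.
rewrite !ulim0//; apply: filterS (filterI UA UB) => k /= [nA nB].
by case.
Qed.

(** The ultrafilter contains the set of k with d_k in A or its complement, and u(A) records which.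
    These are the d_k kept in the tail. *)
Lemma ulim_agree (A : set Omega) : U [set k | \1_A (dpath k) = ulim R U A].
Proof.
have [UA|UA] := in_ultra_setVsetC [set k | A (dpath k)] ultraU.
  by rewrite (ulim1 UA); apply: filterS UA => k Ak /=; rewrite indicE mem_set.
by rewrite (ulim0 UA); apply: filterS UA => k Ak /=; rewrite indicE memNset.
Qed.

(** Among the d_j only d_k can lie in C_k, and every tail of indices belongs to [U]. *)
Lemma ulim_branch k (A : set Omega) : A `<=` cyl (dpath k) k.+1 -> ulim R U A = 0.
Proof.
move=> Ak; apply: ulim0; apply: filterS (free_ultrafilter_ge k.+1) => j /= kj.
by move/Ak/(cyl_dpath_inj (@cylxx _ _)) => jk; move: kj; rewrite jk ltnn.
Qed.

Lemma ulim_cyl_zero n (A : set Omega) :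
  ulim R U (A `&` cyl (fun=> false) n) = ulim R U A.
Proof.
rewrite /ulim; congr (if _ then _ else _); apply/asbool_equiv_eq; split.
  by apply: filterS => k [].
move=> UA; apply: filterS (filterI UA (free_ultrafilter_ge n)) => k [Ak nk].
by split => //; exact: cyl_dpath_zero.
Qed.

End ulim.

(** * Cylinders shrinking to a point *)

Section shrinking_cylinders.
Context {R : realType} (mu : probability Omega R).
Local Notation pr := (prob mu).

Lemma bigcap_cyl (w : Omega) : \bigcap_n cyl w n = [set w].
Proof.
apply/seteqP; split=> [x h|x ->] //=; apply/funext => i.
exact: (h i.+1 Logic.I).
Qed.

Lemma prob_cyl_cvg (w : Omega) : pr (cyl w n) @[n --> \oo] --> pr [set w].
Proof.
rewrite -bigcap_cyl; apply: prob_bigcap_cvg => [n|m n]; first exact: measurable_cyl.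
exact: cyl_le.
Qed.

Lemma prob_cyl_eventually (w : Omega) (e : R) : 0 < e ->
  exists N, forall n, (N <= n)%N -> pr (cyl w n `\ w) < e.
Proof.
move=> e0; have /cvgrPdist_lt h := @prob_cyl_cvg w.
have [N _ hN] := h _ e0; exists N => n Nn.
have mw := measurable_set1_Omega w; have mc := measurable_cyl w n.
have := hN n Nn; rewrite /= distrC => /ltr_normlW.
have wc : [set w] `<=` cyl w n by move=> x ->.
by rewrite (probID mu mc mw) (setIidr wc) addrC addKr.
Qed.

End shrinking_cylinders.

(** * Properties of the mixture of u and R_0 *)

Section mixture.
Context {R : realType} {U : set_system nat} (theta : nat -> R).
Hypothesis freeU : free_ultrafilter U.
Hypothesis theta01 : forall k, 0 < theta k < 1.
Variable mu : probability Omega R.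
Hypothesis muE : forall A, mu A = R0 theta A.
Local Notation pr := (prob mu).
Local Notation zero := ((fun=> false) : Omega).
Local Notation P := (Pmix U theta).

Let tweight_gt0 k : 0 < tweight R k.
Proof. by rewrite /tweight exprn_gt0// invr_gt0. Qed.

Lemma PmixE alpha (A : borel) :
  P alpha A = alpha * ulim R U A + (1 - alpha) * pr A.
Proof. by rewrite /Pmix /prob muE. Qed.

Lemma prob_cyl_gt0 w n : 0 < pr (cyl w n).
Proof. by rewrite -lte_fin -probE ?muE ?R0_cyl_gt0//; exact: measurable_cyl. Qed.

Lemma prob_zero : pr [set zero] = 0.
Proof. by rewrite /prob muE R0_zero. Qed.

(** Without its atom d_k, the branch retains only the coin part. With [prob_dpath_ge] this gives the
    ratio theta_k / (1 - theta_k). *)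
Lemma prob_cyl_dpath_sub k n : (k < n)%N ->
  pr (cyl (dpath k) n `\ dpath k) <= tweight R k * theta k.
Proof.
move=> kn; have mc := measurable_cyl (dpath k) n.
have mD := measurableD mc (measurable_set1_Omega (dpath k)).
rewrite -lee_fin -probE// muE (@R0_on_branch _ _ theta01 k); last first.
  by move=> x [+ _]; exact: cyl_le.
rewrite diracE memNset; last by case=> _; apply.
have /andP[/ltW t0 _] := theta01 k.
rewrite mule0 add0e EFinM; apply: lee_wpmul2l; first by rewrite lee_fin ltW.
rewrite -[leRHS]mule1; apply: lee_wpmul2l; first by rewrite lee_fin.
apply: probability_le1; rewrite -[X in measurable X]setTI.
exact: measurable_shift_path.
Qed.

Lemma prob_dpath_ge k : tweight R k * (1 - theta k) <= pr [set dpath k].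
Proof.
have mD := measurable_set1_Omega (dpath k).
rewrite -lee_fin -probE// muE (@R0_on_branch _ _ theta01 k); last by move=> x ->.
rewrite diracE mem_set// mule1 EFinM.
have /andP[/ltW t0 _] := theta01 k.
apply: lee_wpmul2l; first by rewrite lee_fin ltW.
by apply: leeDl; apply: mule_ge0; [rewrite lee_fin|exact: measure_ge0].
Qed.

Lemma posterior_err alpha n (A : borel) w (r : R) :
  0 < P alpha (borel_cyl w n) ->
  `|P alpha (borelI A (borel_cyl w n)) - \1_(bset A) w * P alpha (borel_cyl w n)|
    < r * P alpha (borel_cyl w n) ->
  `|posterior (P alpha) n A w - \1_(bset A) w| < r.
Proof.
move=> c0 h; rewrite /posterior -(ltr_pM2r c0) -[X in _ * X < _]gtr0_norm//.
by rewrite -normrM mulrBl divfK// gt_eqF.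
Qed.

Section alpha.
Variable alpha : R.
Hypothesis alpha01 : 0 < alpha < 1.

Let alpha_gt0 : 0 < alpha. Proof. by case/andP: alpha01. Qed.
Let onem_alpha_gt0 : 0 < 1 - alpha.
Proof. by case/andP: alpha01; rewrite subr_gt0. Qed.

(** The factor 1 - alpha cancels in posteriors, which on a branch are thus those of R_0. *)
Lemma Pmix_branch k (A : borel) : bset A `<=` cyl (dpath k) k.+1 ->
  P alpha A = (1 - alpha) * pr A.
Proof. by move=> Ak; rewrite PmixE (ulim_branch R freeU Ak) mulr0 add0r. Qed.

Lemma Pmix_probability : probability_function (P alpha).
Proof.
split.
- move=> A; rewrite PmixE.
  have u0 := @ulim_ge0 R U A; have u1 := @ulim_le1 R U A.
  have p0 := prob_ge0 mu A.
  have p1 : pr A <= 1 by rewrite -lee_fin -probE ?probability_le1//; exact: borelP.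
  have a0 := alpha_gt0; have a1 := onem_alpha_gt0.
  by apply/andP; split; nra.
- by rewrite PmixE probT mulr1 (ulim_all R freeU)// mulr1 addrC subrK.
- move=> A B AB; rewrite !PmixE /= (ulimU R freeU AB) probU//; try exact: borelP.
  ring.
Qed.

Lemma Pmix_not_countably_additive : ~ countably_additive (P alpha).
Proof.
pose F k := borel_cyl (dpath k) k.+1.
have tF : trivIset setT (fun n => F n : set Omega).
  by apply/trivIsetP => i j _ _ /eqP ij; rewrite -subset0 => x [xi xj];
    apply: ij; exact: cyl_dpath_inj xi xj.
move=> /(_ F tF).
have mF n : measurable (F n : set Omega) by exact: borelP.
have h : (fun n => \sum_(0 <= i < n) (pr (F i))) @ \oo --> pr (\bigcup_n F n).
  have := @measure_semi_sigma_additive _ _ _ mu _ mF tF (bigcupT_measurable _ mF).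
  rewrite [X in _ --> X]probE; last exact: bigcupT_measurable.
  move/fine_cvg; apply: cvg_trans; apply: near_eq_cvg; apply: nearW => n /=.
  rewrite (eq_bigr (fun i => (pr (F i))%:E)) => [|i _]; last exact: (probE mu (mF i)).
  by rewrite sumEFin.
have {}h : series (fun n => P alpha (F n)) @ \oo -->
    (1 - alpha) * pr (\bigcup_n F n).
  rewrite (_ : series _ = fun n => (1 - alpha) * \sum_(0 <= i < n) pr (F i)).
    exact: cvgMr.
  apply/funext => n; rewrite /series/= mulr_sumr; apply: eq_bigr => i _.
  by rewrite (@Pmix_branch i).
move=> h2.
(* Both sides would be limits of the same series; as the union contains every d_k, its u-mass 1
   forces alpha = 0. *)
have : (1 - alpha) * pr (\bigcup_n F n) = P alpha (borel_bigcup F).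
  exact: cvg_unique h h2.
rewrite PmixE (ulim_all R freeU) => [e|k]; last by exists k.
by have := alpha_gt0; lra.
Qed.

Lemma Pmix_cyl_gt0 w n : 0 < P alpha (borel_cyl w n).
Proof.
rewrite PmixE; apply: ltr_wpDl; first by rewrite mulr_ge0 ?ulim_ge0// ltW.
by rewrite mulr_gt0//; exact: prob_cyl_gt0.
Qed.

Lemma Pmix_converges : theta @ \oo --> (0 : R) ->
  converges_to_truth_almost_uniformly (P alpha).
Proof.
move=> theta_cvg A eps eps0.
have mA : measurable (bset A) := borelP A.
have tail (e : R) : 0 < e ->
    exists N, forall n, (N <= n)%N -> pr (cyl zero n) < e.
  move=> e0; have /cvgrPdist_lt h := @prob_cyl_cvg _ mu zero.
  have [N _ hN] := h _ e0; exists N => n Nn; have := hN n Nn.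
  by rewrite /= prob_zero sub0r normrN => /ltr_normlW.
have e20 : 0 < eps / 2 by rewrite divr_gt0.
have [k0 /(_ k0 (leqnn k0)) hk0] := tail _ e20.
have [E1 [mE1 prE1 levy]] := levy_almost_uniform mu mA e20.
pose Z := cyl zero k0; have mZ : measurable Z := measurable_cyl zero k0.
(* [D] is countable, hence Borel. *)
pose D : set Omega := dpath @` [set k | \1_(bset A) (dpath k) = ulim R U A].
have mD : measurable D.
  apply: countable_measurable; first exact: measurable_set1_Omega.
  exact: sub_countable (card_image_le _ _) (countableP _).
have mE1Z := measurableD mE1 mZ; have mZD := measurableD mZ mD.
(* Removed are Levy's exceptional set outside the tail cylinder [Z], and all of [Z] except [D]. *)
pose E := Borel (measurableU _ _ mE1Z mZD).
exists E.
  (* For [U]-many k, d_k lies in both [Z] and [D], hence outside [E], so u(E) = 0. *)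
  rewrite PmixE ulim0 //= ?mulr0 ?add0r; last first.
    have [/(@ultra_proper _ _) UU _] := freeU.
    apply: filterS (filterI (ulim_agree R freeU A) (free_ultrafilter_ge freeU k0)).
    move=> k [/= kD k0k] [[_ +]|[_]]; apply; first exact: cyl_dpath_zero.
    by exists k.
  apply: (@le_lt_trans _ _ (pr (E1 `\` Z `|` Z `\` D))).
    by rewrite ler_piMl ?prob_ge0// gerBl ltW.
  apply: le_lt_trans (probU_le mu mE1Z mZD) _; rewrite (splitr eps).
  apply: ler_ltD.
    by apply: le_trans prE1; apply: prob_le => // x [].
  by apply: le_lt_trans hk0; apply: prob_le => // x [].
move=> r r0.
have [N1 hN1] := levy (r / 2) (divr_gt0 r0 (ltr0Sn _ _)).
have [N2 hN2] := tail (r * alpha) (mulr_gt0 r0 alpha_gt0).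
(* The inequality says theta_k < r / (1 + r), which holds eventually. *)
have [Kr hKr] : exists K, forall k, (K <= k)%N -> theta k < r * (1 - theta k).
  have r1 : 0 < 1 + r by rewrite addr_gt0.
  have /cvgrPdist_lt h := theta_cvg.
  have [K _ hK] := h _ (divr_gt0 r0 r1); exists K => k Kk.
  have := hK k Kk; rewrite /= sub0r normrN => /ltr_normlW.
  by rewrite ltr_pdivlMr//; lra.
have point_gt0 k : 0 < pr [set dpath k].
  apply: lt_le_trans (prob_dpath_ge k); have /andP[_ t1] := theta01 k.
  by rewrite mulr_gt0// subr_gt0.
(* The finitely many k below [Kr] get individual thresholds, from cylinders shrinking to the atom
   d_k. *)
have /choice[N3 hN3] k :=
  prob_cyl_eventually mu (dpath k) (mulr_gt0 r0 (point_gt0 k)).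
(* The summand [k0] makes n exceed the position of the first 1 of any [w] outside [Z]. *)
exists (N1 + N2 + k0 + \max_(k < Kr) N3 k).+1%N => // n w Nn nE.
have c0 := Pmix_cyl_gt0 w n; apply: posterior_err => //.
have mc := measurable_cyl w n.
have [Zw|nZw] := pselect (Z w); last first.
  have nE1 : ~ E1 w by move=> E1w; apply: nE; left.
  have [k kk0 wk] := cyl_first_one nZw.
  have ck : cyl w n `<=` cyl (dpath k) k.+1.
    by rewrite -(cyl_eq wk); apply: cyl_le; lia.
  rewrite !(@Pmix_branch k)//=; last by move=> x [_ /ck].
  rewrite mulrCA -mulrBr normrM gtr0_norm// mulrCA ltr_pM2l//.
  apply: le_lt_trans (hN1 n w _ nE1) _; first lia.
  by rewrite ltr_pM2r ?prob_cyl_gt0// ltr_pdivrMr// ltr_pMr// ltr1n.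
have [k kA dkw] : D w by apply: contrapT => nDw; apply: nE; right.
rewrite /= in kA; subst w.
(* The point is now some d_k with 1_A(d_k) = u(A). For n <= k its cylinder is still that of the zero
   path. *)
have [nk|kn] := leqP n k.
  have cE : cyl (dpath k) n = cyl zero n.
    by apply: cyl_eq; exact: cyl_dpath_zero.
  have uc : ulim R U (cyl zero n) = 1.
    by rewrite -[cyl zero n]setTI (ulim_cyl_zero R freeU) (ulim_all R freeU).
  rewrite !PmixE /= cE kA (ulim_cyl_zero R freeU) uc mulr1.
  have c1 : pr (cyl zero n) < r * alpha by apply: hN2; lia.
  have c2 := prob_cyl_gt0 zero n.
  have i0 := prob_ge0 mu (A `&` cyl zero n).
  have i1 : pr (A `&` cyl zero n) <= pr (cyl zero n).
    by apply: prob_le => //; [apply: measurableI => //|]; exact: measurable_cyl.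
  have u0 := @ulim_ge0 R U A; have u1 := @ulim_le1 R U A.
  (* The u-parts cancel exactly; what remains is at most the R_0-mass of the cylinder, below r
     alpha, while P gives the cylinder at least alpha. *)
  rewrite (_ : _ - _ =
    (1 - alpha) * (pr (A `&` cyl zero n) - ulim R U A * pr (cyl zero n))); last ring.
  apply: (@le_lt_trans _ _ (pr (cyl zero n))).
    rewrite normrM gtr0_norm// -[leRHS]mul1r; apply: ler_pM => //.
    - exact: ltW.
    - by rewrite gerBl ltW.
    - by rewrite ler_norml; apply/andP; split; nra.
  by apply: lt_le_trans c1 _; rewrite ler_pM2l// lerDl mulr_ge0 ?prob_ge0// ltW.
have ck : cyl (dpath k) n `<=` cyl (dpath k) k.+1 by exact: cyl_le.
rewrite !(@Pmix_branch k)//=; last by move=> x [_ /ck].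
rewrite mulrCA -mulrBr normrM gtr0_norm// mulrCA ltr_pM2l//.
(* For n > k the error can only come from points other than d_k itself. *)
apply: (@le_lt_trans _ _ (pr (cyl (dpath k) n `\ dpath k))).
  rewrite setDE; apply: prob_cond_err => //.
    exact: measurableC (measurable_set1_Omega _).
  by move=> y _ /contrapT ->.
have pc : pr [set dpath k] <= pr (cyl (dpath k) n).
  by apply: prob_le => //; [exact: measurable_set1_Omega|move=> x ->].
(* Large k use theta_k -> 0, the others their own threshold. *)
have [Krk|kKr] := leqP Kr k.
  apply: le_lt_trans (prob_cyl_dpath_sub kn) _.
  apply: (@lt_le_trans _ _ (r * (tweight R k * (1 - theta k)))).
    by rewrite mulrCA ltr_pM2l// hKr.
  by rewrite ler_pM2l//; apply: le_trans pc; exact: prob_dpath_ge.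
apply: (@lt_le_trans _ _ (r * pr [set dpath k])); last by rewrite ler_pM2l.
apply: hN3; apply: leq_trans (ltnW Nn); apply: leq_trans (leq_addl _ _).
exact: (leq_bigmax (F := fun k : 'I_Kr => N3 k) (Ordinal kKr)).
Qed.

End alpha.

(** On C_0 the measure u vanishes and R_0 is positive, so the value (1 - alpha) R_0(C_0) determines
    alpha. *)
Lemma Pmix_inj_of_measure alpha beta : 0 < alpha < 1 -> 0 < beta < 1 ->
  P alpha = P beta -> alpha = beta.
Proof.
move=> a01 b01 /(congr1 (fun f => f (borel_cyl (dpath 0) 1))).
rewrite !(@Pmix_branch _ 0%N)//= => /(mulIf (lt0r_neq0 (prob_cyl_gt0 _ _))).
lra.
Qed.

End mixture.

(** * The family P_alpha and uncountability *)

Section mixture_theorem.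
Context {R : realType} {U : set_system nat} {theta : nat -> R}.
Hypothesis freeU : free_ultrafilter U.
Hypothesis theta01 : forall k, 0 < theta k < 1.

Lemma Pmix_converging alpha : theta @ \oo --> (0 : R) -> 0 < alpha < 1 ->
  [/\ merely_finitely_additive (Pmix U theta alpha),
      positive_on_cylinders (Pmix U theta alpha) &
      converges_to_truth_almost_uniformly (Pmix U theta alpha)].
Proof.
move=> theta0 alpha01; have [mu muE] := R0_probability theta01; split.
- split; first exact: Pmix_probability muE _ alpha01.
  exact: Pmix_not_countably_additive muE _ alpha01.
- by move=> w n _; exact: Pmix_cyl_gt0 muE _ alpha01 _ _.
- exact: Pmix_converges muE _ alpha01 theta0.
Qed.

Lemma Pmix_inj alpha beta : 0 < alpha < 1 -> 0 < beta < 1 ->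
  Pmix U theta alpha = Pmix U theta beta -> alpha = beta.
Proof.
have [mu muE] := R0_probability theta01.
exact: (Pmix_inj_of_measure freeU theta01 muE).
Qed.

End mixture_theorem.

(** Any ultrafilter refining the cofinite filter is free. *)
Lemma free_ultrafilter_exists : exists U, free_ultrafilter U.
Proof.
have [U [UU hU]] := ultraFilterLemma eventually_filter.
have PU : ProperFilter U := @ultra_proper _ _ UU.
exists U; split => // A /finite_seqP[s sA] UA.
have UC : U (~` A).
  apply: hU; exists (\max_(i <- s) i).+1 => // n /= sn An.
  have ns : n \in s by move: An; rewrite sA.
  by move: sn; rewrite ltnNge (@leq_bigmax_seq _ s xpredT id).
have UI : U (A `&` ~` A) by apply: filterI.
by have [k []] := @filter_ex _ _ PU _ UI.
Qed.

(** Countable sets are Lebesgue null, and the interval has length 1. *)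
Lemma uncountable_itv01 (R : realType) : ~ countable `]0, (1 : R)[%classic.
Proof.
move=> /countable_lebesgue_measure0; rewrite lebesgue_measure_itv/= lte_fin ltr01.
by rewrite sube0 => -[]/eqP; rewrite oner_eq0.
Qed.

Unset Implicit Arguments.

Theorem theorem7p3 (R : realType) :
  (forall (U : set_system nat) (theta : nat -> R),
     free_ultrafilter U ->
     (forall k, 0 < theta k < 1) ->
     theta @ \oo --> (0 : R) ->
     (forall alpha : R, 0 < alpha < 1 ->
        [/\ merely_finitely_additive (Pmix U theta alpha),
            positive_on_cylinders (Pmix U theta alpha) &
            converges_to_truth_almost_uniformly (Pmix U theta alpha)]) /\
     (forall alpha beta : R, 0 < alpha < 1 -> 0 < beta < 1 ->
        alpha <> beta -> Pmix U theta alpha <> Pmix U theta beta)) /\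
  ~ countable [set P : borel -> R |
      [/\ merely_finitely_additive P,
          positive_on_cylinders P &
          converges_to_truth_almost_uniformly P]].
Proof.
split=> [U theta freeU theta01 theta0|cS].
  split=> [alpha|alpha beta a01 b01 ab /(Pmix_inj freeU theta01 a01 b01)//].
  exact: Pmix_converging.
have [U freeU] := free_ultrafilter_exists.
(* The shift by 2 keeps the value at index 0 below 1. *)
pose theta (k : nat) : R := k.+2%:R^-1.
have th01 k : 0 < theta k < 1.
  by rewrite invr_gt0 ltr0Sn /= invf_lt1 ?ltr0Sn// ltr1n.
have th0 : theta @ \oo --> (0 : R).
  apply/cvgrPdist_lt => e e0.
  have [N _ hN] := near_infty_natSinv_lt (PosNum e0); exists N => // n Nn.
  rewrite /= sub0r normrN gtr0_norm; last by case/andP: (th01 n).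
  by apply: (hN n.+1); exact: leqW.
(* For one fixed [U] and [theta], alpha embeds the open unit interval into the supposedly countable
   set. *)
apply: (@uncountable_itv01 R); apply: sub_countable cS.
have injP : {in `]0, (1 : R)[%classic &, injective (Pmix U theta)}.
  move=> a b; rewrite !inE /= !in_itv /= => a01 b01; exact: Pmix_inj.
rewrite -(card_le_eql (inj_card_eq injP)).
apply: subset_card_le => P [a + <-]; rewrite /= in_itv /= => a01.
exact: Pmix_converging.
Qed.
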